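(* Let $\mathbf{r}=(r_1,\dots,r_N)'$ be the random one-period returns of $N$ risky assets ($N$ sufficiently large) with expected returns $\boldsymbol\mu=(\mu_1,\dots,\mu_N)'$, and let $r_f$ be the return of a risk-free asset. Suppose the $N$ risky assets form a complete market. For $j\in\{1,\dots,N\}$, let $\mathbf{w}_j\in\mathbb{R}^N$ be the weight vector of the tangency portfolio obtained from mean-variance analysis of the $N-1$ risky assets other than asset $j$ together with the risk-free asset (so the $j$-th entry of $\mathbf{w}_j$ is $0$ and $\mathbf{w}_j'\mathbf{1}_N=1$), and let $\mu_{j,M}=E(\mathbf{w}_j'\mathbf{r})$ be its expected return. Then \[ \mu_j-r_f=\rho_j\,(\mu_{j,M}-r_f),\qquad \rho_j:=\frac{\mathrm{Cov}(r_j,\mathbf{w}_j'\mathbf{r})}{\mathrm{Var}(\mathbf{w}_j'\mathbf{r})}. \]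
   Context: $\mathbf{1}_N=(1,\dots,1)'\in\mathbb{R}^N$. All returns have finite second moments. Complete market: the market of $N$ risky assets is complete if, for every $j$, the return $r_j$ can be expressed as a linear combination of the returns of the remaining $N-1$ assets (those indexed by $\{1,\dots,N\}\setminus\{j\}$), but $r_j$ cannot be replicated using only $N-2$ assets from $\{1,\dots,N\}\setminus\{j\}$. In such a market no-arbitrage holds: riskless profits cannot be generated through linear combinations of the available assets (risky and risk-free); i.e. a zero-cost portfolio with nonrandom return has return $0$. Tangency portfolio without asset $j$: the portfolio of risky assets with weights $\mathbf{w}$ satisfying $w_j=0$, $\mathbf{w}'\mathbf{1}_N=1$ that lies on the capital allocation line of the $N-1$ remaining risky assets and the risk-free asset, i.e. which maximizes the slope $(E(\mathbf{w}'\mathbf{r})-r_f)/\sqrt{\mathrm{Var}(\mathbf{w}'\mathbf{r})}$ among all such weights; $\mathrm{Var}(\mathbf{w}_j'\mathbf{r})>0$. The number $\rho_j$ is called the ''spatial rho'' of asset $j$. *)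

(* Defs.v *)
From HB Require Import structures.
From mathcomp Require Import all_boot all_order all_algebra.
From mathcomp Require Import all_classical all_reals all_analysis.

Set Implicit Arguments.
Unset Strict Implicit.
Unset Printing Implicit Defensive.

Import Order.TTheory GRing.Theory Num.Theory.

Local Open Scope ring_scope.

Section Market.
Context {d : measure_display} {T : measurableType d} {R : realType}
        {P : probability T R} {N : nat}.
Implicit Types (r : 'I_N -> {RV P >-> R}) (w : 'cV[R]_N) (rf : R).

Definition portfolio_return r w : T -> R := fun t => \sum_i w i 0 * r i t.

(* Expectation, variance and covariance are extended-real valued in the
   library; [fine] loses nothing for square-integrable variables. *)
Definition mean_return r w : R := fine 'E_P[portfolio_return r w].

Definition var_return r w : R := fine 'V_P[portfolio_return r w].

(* Equality of returns is equality almost surely. *)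
Definition replicable r (j : 'I_N) (B : {set 'I_N}) : Prop :=
  exists a : 'I_N -> R, {ae P, forall t, r j t = \sum_(i in B) a i * r i t}.

Definition complete_market r : Prop :=
  forall j : 'I_N,
    replicable r j (~: [set j]) /\
    (forall B : {set 'I_N}, B \subset ~: [set j] -> #|B| = (N - 2)%N ->
       ~ replicable r j B).

(* [h0] is the position in the risk-free asset. *)
Definition no_arbitrage r rf : Prop :=
  forall (h0 : R) (h : 'cV[R]_N) (c : R),
    h0 + \sum_i h i 0 = 0 ->
    {ae P, forall t, h0 * rf + portfolio_return r h t = c} ->
    c = 0.

Definition feasible_without r (j : 'I_N) w : Prop :=
  [/\ w j 0 = 0, \sum_i w i 0 = 1 & 0 < var_return r w].

Definition slope r rf w : R :=
  (mean_return r w - rf) / Num.sqrt (var_return r w).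

(* Competing portfolios are those of positive variance, for which the slope is
   defined. *)
Definition tangency_without r rf (j : 'I_N) w : Prop :=
  feasible_without r j w /\
  (forall v : 'cV[R]_N, feasible_without r j v -> slope r rf v <= slope r rf w).

Definition spatial_rho r (j : 'I_N) w : R :=
  fine (covariance P (r j) (portfolio_return r w)) / var_return r w.

End Market.

(* Main.v *)
Require Import Defs.
From HB Require Import structures.
From mathcomp Require Import all_boot all_order all_algebra.
From mathcomp Require Import all_classical all_reals all_analysis.
From mathcomp Require Import ring lra.
Import Order.TTheory GRing.Theory Num.Theory.
Local Open Scope ring_scope.

(* Moving the tangency portfolio w slightly towards an available asset i, i.e.
   to w + t (e_i - w), stays feasible, so the slope is stationary at t = 0; this
   first-order condition is the pricing equation
   (mu_i - rf) Var(w'r) = (mu_M - rf) Cov(r_i, w'r) for each i <> j. Absence of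
   arbitrage against the replica sum_i a_i r_i of r_j gives
   mu_j - rf = sum_i a_i (mu_i - rf), so the pricing equation extends to j by
   linearity of the covariance. *)

(** * First-order condition for a maximal slope along a line of portfolios *)

Lemma is_derive_quadratic (R : realType) (V c e t : R) :
  is_derive t (1 : R) (fun s : R => V + 2 * c * s + e * s ^+ 2)
    (2 * c + 2 * e * t).
Proof.
apply: is_derive_eq.
by rewrite /GRing.scale /=; ring.
Qed.

(** Along a line of portfolios the excess mean is [m + b * t] and the variance is
    [V + 2 * c * t + e * t ^+ 2]; the conclusion is the vanishing of the slope's derivative at
    [t = 0], cleared of denominators. *)
Lemma slope_max_foc (R : realType) (m b V c e : R) : 0 < V ->
  (forall t, 0 < V + 2 * c * t + e * t ^+ 2 ->
     (m + b * t) / Num.sqrt (V + 2 * c * t + e * t ^+ 2) <= m / Num.sqrt V) ->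
  b * V = m * c.
Proof.
move=> V0 Hmax.
pose q t := V + 2 * c * t + e * t ^+ 2.
(* The summand [V] in [K] makes [K] positive and [D <= 1]. So [|t| < D] gives [t ^+ 2 <= |t|] and
   [(2 * |c| + |e|) * |t| < V], which keeps the variance positive. *)
pose K := 2 * `|c| + `|e| + V; pose D := V / K.
have K0 : 0 < K by rewrite ltr_wpDl// addr_ge0// mulr_ge0.
have D0 : 0 < D by rewrite divr_gt0.
have q0 t : t \in `]- D, D[ -> 0 < q t.
  rewrite in_itv /= -ltr_norml => tD.
  have t1 : `|t| <= 1.
    rewrite (le_trans (ltW tD))// ler_pdivrMr// mul1r /K lerDr.
    by rewrite addr_ge0// mulr_ge0.
  have tK : `|t| * K < V by rewrite -ltr_pdivlMr.
  have ct : - (`|c| * `|t|) <= c * t.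
    by rewrite lerNl (le_trans (ler_norm _))// normrN normrM.
  have et : - (`|e| * `|t|) <= e * t ^+ 2.
    rewrite lerNl (le_trans (ler_norm _))// normrN normrM ler_wpM2l// normrX.
    by rewrite expr2 ler_piMl.
  have := mulr_ge0 (normr_ge0 t) (ltW V0).
  by rewrite /q; rewrite /K in tK; nra.
(* The slope inequality multiplied by both square roots says [g t <= 0 = g 0], so [g] is maximal at
   0 and no quotient has to be differentiated. *)
pose g t := (m + b * t) * Num.sqrt V - m * Num.sqrt (q t).
have dg t : t \in `]- D, D[ -> is_derive t (1 : R) g
    (b * Num.sqrt V - m * ((2 * c + 2 * e * t) * (2 * Num.sqrt (q t))^-1)).
  move=> /q0 qt.
  have dq : is_derive t (1 : R) q (2 * c + 2 * e * t) := is_derive_quadratic _ _ _ _ _.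
  have ds := is_derive1_sqrt qt.
  have dsq : is_derive t (1 : R) (Num.sqrt \o q)
      ((2 * Num.sqrt (q t))^-1 * (2 * c + 2 * e * t)).
    exact: is_derive1_comp.
  have -> : g = ((cst m + b *: id) * cst (Num.sqrt V) - m *: (Num.sqrt \o q)).
    by apply/funext => s.
  apply: is_derive_eq.
  by rewrite /GRing.scale /=; ring.
have in0 : (0 : R) \in `]- D, D[ by rewrite in_itv /= oppr_lt0 D0.
have q00 : q 0 = V by rewrite /q expr0n /= !mulr0 !addr0.
have sV : 0 < Num.sqrt V by rewrite sqrtr_gt0.
have g0 : g 0 = 0 by rewrite /g q00 mulr0 addr0 subrr.
have : is_derive (0 : R) (1 : R) g 0.
  apply: (@derive1_at_max _ _ (- D) D) => //.
  - by rewrite lerNl (le_trans _ (ltW D0))// oppr_le0 ltW.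
  - by move=> t /dg dgt; exact: ex_derive.
  move=> t /q0 qt; rewrite g0 /g subr_le0.
  have := Hmax t qt; rewrite -/(q t).
  by rewrite ler_pdivrMr ?sqrtr_gt0// mulrAC ler_pdivlMr.
move=> /(@derive_val _ _ _ _ _ _ _) D0E.
have := dg 0 in0 => /(@derive_val _ _ _ _ _ _ _).
rewrite D0E q00 mulr0 addr0 => /eqP; rewrite eq_sym subr_eq0 => /eqP E.
rewrite -[V in LHS]sqr_sqrtr ?ltW// expr2 mulrA E.
by field; rewrite gt_eqF.
Qed.

(** * Mean and covariance as linear functionals on square-integrable variables *)

Section second_moments.
Context {d : measure_display} {T : measurableType d} {R : realType}
  (P : probability T R).
Local Notation L2 := (Lfun P 2%:E).
Implicit Types (X Y Z : T -> R).

Lemma Lfun2_Lfun1 X : X \in L2 -> X \in Lfun P 1.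
Proof. by apply: Lfun_subset12; exact: fin_num_measure. Qed.

Lemma Lfun2_0 : (0 : T -> R) \in L2.
Proof. exact: Lfun_cst. Qed.

Lemma Lfun2_lin (a : R) X Y : X \in L2 -> Y \in L2 -> a *: X + Y \in L2.
Proof.
have two : (1 <= 2%:E :> \bar R)%E by rewrite lee1n.
by move=> X2 Y2; have [_] := Lfun_submod_closed P two; apply.
Qed.

Lemma Lfun2_sum (I : finType) (a : I -> R) (X : I -> T -> R) :
  (forall i, X i \in L2) -> \sum_i a i *: X i \in L2.
Proof.
move=> X2; apply: (big_ind (fun Y => Y \in L2)).
- exact: Lfun2_0.
- by move=> Y Z Y2 Z2; rewrite -[Y]scale1r; exact: Lfun2_lin.
- move=> i _; rewrite -[_ *: _]addr0; exact: Lfun2_lin (X2 i) Lfun2_0.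
Qed.

Definition mean X : R := fine 'E_P[X].
Definition cov X Y : R := fine (covariance P X Y).

Lemma covC X Y : cov X Y = cov Y X. Proof. by rewrite /cov covarianceC. Qed.

Lemma mean_lin (a : R) X Y : X \in L2 -> Y \in L2 ->
  mean (a *: X + Y) = a * mean X + mean Y.
Proof.
move=> X2 Y2; have X1 := Lfun2_Lfun1 _ X2; have Y1 := Lfun2_Lfun1 _ Y2.
have aX : a *: X = a \o* X by apply/funext => t; rewrite /= mulrC.
have aX1 : a *: X \in Lfun P 1.
  apply: Lfun2_Lfun1; rewrite aX; apply: Lfun_scale => //; exact: ler1n.
rewrite /mean expectationD// fineD ?expectation_fin_num// aX expectationZl//.
by rewrite fineM ?expectation_fin_num.
Qed.

Lemma cov_linl (a : R) X Y Z : X \in L2 -> Y \in L2 -> Z \in L2 ->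
  cov (a *: X + Y) Z = a * cov X Z + cov Y Z.
Proof.
move=> X2 Y2 Z2.
have fin A B : A \in L2 -> B \in L2 -> covariance P A B \is a fin_num.
  move=> A2 B2; apply: covariance_fin_num; try exact: Lfun2_Lfun1.
  exact: Lfun2_mul_Lfun1.
have aX : a *: X = a \o* X by apply/funext => t; rewrite /= mulrC.
have aX2 : a *: X \in L2 by rewrite aX; apply: Lfun_scale => //; exact: ler1n.
rewrite /cov covarianceDl// fineD ?fin// aX covarianceZl.
- by rewrite fineM ?fin.
- exact: Lfun2_Lfun1.
- exact: Lfun2_Lfun1.
- exact: Lfun2_mul_Lfun1.
Qed.

(** Bilinearity and symmetry; this puts the variance along a line in the quadratic form required by
    [slope_max_foc]. *)
Lemma cov_lin_diag (a : R) X Y : X \in L2 -> Y \in L2 ->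
  cov (a *: X + Y) (a *: X + Y) =
  cov Y Y + 2 * cov X Y * a + cov X X * a ^+ 2.
Proof.
move=> X2 Y2; have aXY2 := Lfun2_lin a _ _ X2 Y2.
rewrite cov_linl// (covC X) (covC Y (_ + _)) !cov_linl// (covC Y X).
by ring.
Qed.

(** Linearity of [phi] is assumed on L2 only, so the induction carries membership of the partial
    sums along with their values. It serves both for the mean and for the covariance with a fixed
    variable. *)
Lemma linear_sum_Lfun2 (phi : (T -> R) -> R) (I : finType) (a : I -> R)
    (X : I -> T -> R) :
    (forall k Y Z, Y \in L2 -> Z \in L2 -> 
      phi (k *: Y + Z) = k * phi Y + phi Z) ->
    (forall i, X i \in L2) ->
  phi (\sum_i a i *: X i) = \sum_i a i * phi (X i).
Proof.
move=> lin_phi X2.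
have phi0 : phi 0 = 0.
  have := lin_phi 1 0 0 (Lfun2_0) (Lfun2_0).
  rewrite scaler0 addr0 mul1r => /eqP.
  by rewrite -subr_eq0 opprD addNKr oppr_eq0 => /eqP.
suff [] : \sum_i a i *: X i \in L2 /\
    phi (\sum_i a i *: X i) = \sum_i a i * phi (X i) by [].
apply: (big_ind2 (fun Y y => Y \in L2 /\ phi Y = y)).
- by split; [exact: Lfun2_0 | ].
- move=> Y y Z z [Y2 <-] [Z2 <-].
  by rewrite -[Y in Y + _]scale1r Lfun2_lin// lin_phi// mul1r.
- move=> i _; rewrite -[_ *: _]addr0 Lfun2_lin ?Lfun2_0//.
  by rewrite lin_phi ?Lfun2_0// phi0 addr0.
Qed.

(** Replication holds only almost surely, so a return can be exchanged for its replica only inside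
    functionals that ignore null sets. *)
Lemma ae_mean X Y : X \in L2 -> Y \in L2 ->
  {ae P, forall t, X t = Y t} -> mean X = mean Y.
Proof.
move=> /Lfun2_Lfun1/Lfun1_integrable/measurable_int mX.
move=> /Lfun2_Lfun1/Lfun1_integrable/measurable_int mY XY.
rewrite /mean unlock; congr fine; apply: ae_eq_integral => //.
by apply: filterS XY => t /= -> _.
Qed.

Lemma ae_cov X Y Z : X \in L2 -> Y \in L2 -> Z \in L2 ->
  {ae P, forall t, X t = Y t} -> cov X Z = cov Y Z.
Proof.
move=> X2 Y2 Z2 XY.
have ZX := Lfun2_mul_Lfun1 X2 Z2; have ZY := Lfun2_mul_Lfun1 Y2 Z2.
have X1 := Lfun2_Lfun1 _ X2; have Y1 := Lfun2_Lfun1 _ Y2.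
have Z1 := Lfun2_Lfun1 _ Z2.
rewrite /cov !covarianceE// !fineB ?fin_numM ?expectation_fin_num//.
rewrite !fineM ?expectation_fin_num//.
have := ae_mean _ _ X2 Y2 XY; rewrite /mean => ->; congr (_ - _).
move: ZX ZY => /Lfun1_integrable/measurable_int mX.
move=> /Lfun1_integrable/measurable_int mY.
rewrite unlock; congr fine; apply: ae_eq_integral => //.
by apply: filterS XY => t /= XY _; congr (_ * _)%:E.
Qed.

End second_moments.

(** * Portfolio returns, the pricing equation for available assets, and replication *)

Section portfolios.
Context {d : measure_display} {T : measurableType d} {R : realType}
  (P : probability T R) (N : nat) (r : 'I_N -> {RV P >-> R})
  (r2 : forall i : 'I_N, (r i : T -> R) \in Lfun P 2%:E).
Implicit Types (v w : 'cV[R]_N).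

Lemma portfolio_returnE v :
  portfolio_return r v = \sum_i v i 0 *: (r i : T -> R).
Proof. by apply/funext => t; rewrite fct_sumE. Qed.

Lemma portfolio_return_lin (a : R) v w :
  portfolio_return r (a *: v + w) =
  a *: portfolio_return r v + portfolio_return r w.
Proof.
rewrite !portfolio_returnE scaler_sumr -big_split; apply: eq_bigr => i _ /=.
by rewrite !mxE scalerDl scalerA.
Qed.

Lemma portfolio_return_delta i :
  portfolio_return r (delta_mx i 0) = r i :> (T -> R).
Proof.
rewrite portfolio_returnE (bigD1 i)//= big1 => [|k ki].
  by rewrite mxE !eqxx scale1r addr0.
by rewrite mxE (negbTE ki) scale0r.
Qed.

Lemma portfolio_return_Lfun2 v : portfolio_return r v \in Lfun P 2%:E.
Proof. by rewrite portfolio_returnE; exact: Lfun2_sum. Qed.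

Lemma tangency_beta rf (j i : 'I_N) w : tangency_without r rf j w -> i != j ->
  (mean P (r i) - rf) * var_return r w =
  (mean_return r w - rf) * cov P (r i) (portfolio_return r w).
Proof.
move=> [[wj0 wsum V0] wmax] ij.
(* The direction from [w] to asset [i]: its weights sum to 0 and, as [i != j], its entry at [j] is
   0, so moving along it preserves both linear constraints. *)
pose v : 'cV[R]_N := -1 *: w + delta_mx i 0.
set W := portfolio_return r w.
have W2 : W \in Lfun P 2%:E := portfolio_return_Lfun2 w.
set D := portfolio_return r v.
have D2 : D \in Lfun P 2%:E := portfolio_return_Lfun2 v.
have DE : D = -1 *: W + r i.
  by rewrite /D portfolio_return_lin portfolio_return_delta.
have mD : mean P D = mean P (r i) - mean P W.
  by rewrite DE mean_lin// mulN1r addrC.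
have cD : cov P D W = cov P (r i) W - cov P W W.
  by rewrite DE cov_linl// mulN1r addrC.
have meanE t : mean_return r (t *: v + w) = t * mean P D + mean P W.
  by rewrite -[LHS]/(mean P _) portfolio_return_lin mean_lin.
have varE t : var_return r (t *: v + w) =
    var_return r w + 2 * cov P D W * t + cov P D D * t ^+ 2.
  by rewrite -[LHS]/(cov P _ _) portfolio_return_lin cov_lin_diag.
have vsum : \sum_k v k 0 = 0.
  under eq_bigr do rewrite !mxE.
  rewrite big_split /= -mulr_sumr wsum (bigD1 i)//= big1 => [|k ki].
    by rewrite !eqxx mulr1 addr0 addNr.
  by rewrite (negbTE ki).
have := @slope_max_foc R (mean P W - rf) (mean P D) (var_return r w)
  (cov P D W) (cov P D D) V0.
have -> : var_return r w = cov P W W by [].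
rewrite mD cD -[mean_return r w]/(mean P W) => foc.
suff /foc E : forall t : R,
    0 < cov P W W + 2 * (cov P (r i) W - cov P W W) * t + cov P D D * t ^+ 2 ->
    (mean P W - rf + (mean P (r i) - mean P W) * t) /
    Num.sqrt (cov P W W + 2 * (cov P (r i) W - cov P W W) * t +
              cov P D D * t ^+ 2) <=
    (mean P W - rf) / Num.sqrt (cov P W W).
  (* [E] reads [(mu_i - mu_M) * V = (mu_M - rf) * (cov_i - V)]; adding [(mu_M - rf) * V] to both
     sides gives the claim. *)
  by move: E; lra.
move=> t qt; have := wmax (t *: v + w); rewrite /slope meanE varE.
rewrite -[var_return r w]/(cov P W W) -[mean_return r w]/(mean P W) mD cD.
rewrite [t * _ + _ - rf]
  (_ : _ = mean P W - rf + (mean P (r i) - mean P W) * t); last by ring.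
apply; split.
- by rewrite !mxE wj0 [j == i]eq_sym (negbTE ij) /=; ring.
- under eq_bigr do rewrite mxE [X in X + _]mxE.
  by rewrite big_split /= -mulr_sumr vsum wsum mulr0 add0r.
- by rewrite varE -[var_return r w]/(cov P W W) cD.
Qed.

(* Buying asset [j], shorting its replica and lending the balance
   [\sum_i v i 0 - 1] at [rf] is a zero-cost riskless portfolio. *)
Lemma no_arbitrage_replica rf (j : 'I_N) v : no_arbitrage r rf ->
  {ae P, forall t, r j t = portfolio_return r v t} ->
  (\sum_i v i 0 - 1) * rf = 0.
Proof.
move=> hNA hj; pose h : 'cV[R]_N := -1 *: v + delta_mx j 0.
apply: (hNA (\sum_i v i 0 - 1) h).
  have -> : \sum_i h i 0 = - (\sum_i v i 0) + 1.
    under eq_bigr do rewrite !mxE.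
    rewrite big_split /= -mulr_sumr mulN1r [X in _ + X](bigD1 j)//=; congr (_ + _).
    by rewrite !eqxx big1 ?addr0// => k /negbTE ->.
  by ring.
apply: filterS hj => t hj.
rewrite portfolio_return_lin portfolio_return_delta !fctE hj.
by rewrite scaleN1r addNr addr0.
Qed.

End portfolios.

(** * Pricing of asset [j] through its replica *)

Theorem theorem1 (d : measure_display) (T : measurableType d) (R : realType)
  (P : probability T R) (N : nat) (r : 'I_N -> {RV P >-> R}) (rf : R)
  (hN : (2 <= N)%N)
  (hL2 : forall i : 'I_N, (r i : T -> R) \in Lfun P 2%:E)
  (hcomplete : complete_market r)
  (hNA : no_arbitrage r rf)
  (j : 'I_N) (w : 'cV[R]_N)
  (hw : tangency_without r rf j w) :
  fine 'E_P[r j] - rf = spatial_rho r j w * (mean_return r w - rf).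
Proof.
have [[a ha] _] := hcomplete j.
have [[_ _ V0] _] := hw.
(* The replicating coefficients are extended by 0 at [j], so that the replica becomes the return of
   a weight vector. *)
pose v : 'cV[R]_N := \col_i (if i != j then a i else 0).
have hj : {ae P, forall t, r j t = portfolio_return r v t}.
  apply: filterS ha => t ->; rewrite /portfolio_return big_mkcond.
  apply: eq_bigr => i _ /=; rewrite !inE mxE.
  by case: ifP; rewrite ?mul0r.
have v2 := portfolio_return_Lfun2 P N r hL2 v.
have w2 := portfolio_return_Lfun2 P N r hL2 w.
have balance := no_arbitrage_replica P N r rf j v hNA hj.
(* By [balance], [rf] equals [(\sum_i v i 0) * rf], so it can be spread over the replicating
   weights; this also covers [rf = 0], where the weights need not sum to 1. *)
have excess : mean P (r j) - rf = \sum_i v i 0 * (mean P (r i) - rf).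
  under eq_bigr do rewrite mulrBr.
  rewrite sumrB -mulr_suml (ae_mean P _ _ (hL2 j) v2 hj) portfolio_returnE.
  rewrite (linear_sum_Lfun2 P (mean P))//; last exact: mean_lin.
  by move: balance; lra.
have covE : cov P (r j) (portfolio_return r w) =
    \sum_i v i 0 * cov P (r i) (portfolio_return r w).
  rewrite (ae_cov P _ _ _ (hL2 j) v2 w2 hj) [portfolio_return r v]portfolio_returnE.
  rewrite (linear_sum_Lfun2 P (fun X => cov P X (portfolio_return r w)))//.
  by move=> k Y Z Y2 Z2; exact: cov_linl.
rewrite -[LHS]/(mean P (r j) - rf) excess /spatial_rho -[fine _]/(cov P _ _) covE.
(* After multiplication by the variance the two sides agree term by term: the weight is 0 at
   [i = j], and [tangency_beta] applies at every other [i]. *)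
rewrite mulrAC; apply: (canRL (mulfK _)); first by rewrite gt_eqF.
rewrite !mulr_suml; apply: eq_bigr => i _; rewrite mxE.
case: ifPn => [ij|_]; last by rewrite !mul0r.
by rewrite -mulrA (tangency_beta P N r hL2 rf j i w hw ij); ring.
Qed.
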